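(* Let $G$ be a group and $p$ be a prime. (i) $\ell\text{-}\mathcal L(G)$ and $\ell\text{-}\mathcal L(\mathbb Z)$ are asymorphic if and only if $G\simeq\mathbb Z$. (ii) $\ell\text{-}\mathcal L(G)$ and $\ell\text{-}\mathcal L(\mathbb Z_{p^\infty})$ are asymorphic if and only if $G\simeq\mathbb Z_{q^\infty}$ for some prime $q$.
   Context: A ballean is a triple $(X,P,B)$ where $X,P$ are sets, $P\ne\emptyset$, and $B\colon X\times P\to\mathcal P(X)$ satisfies: $x\in B(x,\alpha)$; $x\in B(y,\alpha)$ iff $y\in B(x,\alpha)$; and for all $\alpha,\beta\in P$ there is $\gamma\in P$ such that $B(B(x,\alpha),\beta)\subseteq B(x,\gamma)$ for every $x\in X$, where $B(A,\delta)=\bigcup_{y\in A}B(y,\delta)$. An extended metric (a metric allowed to take the value $\infty$) $d$ on $X$ induces the metric ballean $(X,\mathbb R_{\ge0},B_d)$, with $B_d(x,R)$ the closed ball of centre $x$ and radius $R$. A map $f\colon X\to Y$ between balleans $(X,P_X,B_X)$ and $(Y,P_Y,B_Y)$ is bornologous if for every $\alpha\in P_X$ there is $\beta\in P_Y$ with $f(B_X(x,\alpha))\subseteq B_Y(f(x),\beta)$ for all $x\in X$. An asymorphism is a bijection $f$ such that $f$ and $f^{-1}$ are bornologous; two balleans are asymorphic if there is an asymorphism between them. For a group $G$, let $L(G)$ be the set of all subgroups of $G$. The subgroup logarithmic hyperballean $\ell\text{-}\mathcal L(G)$ is the metric ballean on $L(G)$ induced by the extended metric $d(H,K)=\log\max\{|H:H\cap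 K|,|K:H\cap K|\}$ if both indices are finite, and $d(H,K)=\infty$ otherwise (the base of the logarithm is any fixed real number $>1$). $\mathbb Z_{p^\infty}$ denotes the Prüfer $p$-group. *)

(* Defs.v *)
From HB Require Import structures.
From mathcomp Require Import all_boot all_order all_algebra.
From mathcomp Require Import algC.
From mathcomp Require Import finmap.
From mathcomp Require Import boolp classical_sets functions cardinality.
From mathcomp Require Import reals ereal interval_inference exp.

Set Implicit Arguments.
Unset Strict Implicit.
Unset Printing Implicit Defensive.

Import Order.TTheory GRing.Theory Num.Theory.

Local Open Scope classical_set_scope.
Local Open Scope ring_scope.

Record ballean := Ballean {
  carrier :> Type;
  radius : Type;
  ballB : carrier -> radius -> set carrier;
  radius_inhabited : inhabited radius;
  ballB_center : forall x a, ballB x a x;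
  ballB_sym : forall x y a, ballB y a x <-> ballB x a y;
  ballB_upper : forall a b, exists c, forall x,
    \bigcup_(y in ballB x a) ballB y b `<=` ballB x c
}.

Definition bornologous (X Y : ballean) (f : X -> Y) : Prop :=
  forall a : radius X, exists b : radius Y,
  forall x : X, f @` ballB x a `<=` ballB (f x) b.

Definition asymorphism (X Y : ballean) (f : X -> Y) : Prop :=
  exists g : Y -> X,
    [/\ cancel f g, cancel g f, bornologous f & bornologous g].

Definition asymorphic (X Y : ballean) : Prop :=
  exists f : X -> Y, asymorphism f.

Record extended_metric (R : realType) (X : Type) := ExtendedMetric {
  edist :> X -> X -> \bar R;
  edist_ge0 : forall x y, (0 <= edist x y)%E;
  edist_eq0 : forall x y, edist x y = 0%E <-> x = y;
  edist_sym : forall x y, edist x y = edist y x;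
  edist_triangle : forall x y z, (edist x z <= edist x y + edist y z)%E
}.

Section MetricBallean.
Variables (R : realType) (X : Type) (d : extended_metric R X).

Definition closed_eball (x : X) (r : {nonneg R}) : set X :=
  [set y | (d x y <= r%:num%:E)%E].

Let closed_eball_center x r : closed_eball x r x.
Proof.
by rewrite /closed_eball/= ((edist_eq0 d x x).2 erefl) lee_fin.
Qed.

Let closed_eball_sym x y r : closed_eball y r x <-> closed_eball x r y.
Proof. by rewrite /closed_eball/= edist_sym. Qed.

Let closed_eball_upper (a b : {nonneg R}) : exists c : {nonneg R}, forall x,
  \bigcup_(y in closed_eball x a) closed_eball y b `<=` closed_eball x c.
Proof.
exists (a%:num + b%:num)%:nng => x z [y]; rewrite /closed_eball/= => xy yz.
apply: (le_trans (edist_triangle d x y z)).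
by rewrite EFinD leeD.
Qed.

Definition metric_ballean : ballean :=
  @Ballean X {nonneg R} closed_eball (inhabits 0%:nng)
    closed_eball_center closed_eball_sym closed_eball_upper.

End MetricBallean.

Record subgroup (G : groupType) := Subgroup {
  subgroup_set :> set G;
  subgroup_closed : group_closed [in subgroup_set]
}.

Section Index.
Variable G : groupType.
Implicit Types H K L : set G.

Definition left_cosets H K : set (set G) :=
  [set [set (x * y)%g | y in K] | x in H].

Definition finite_index H K : Prop := finite_set (left_cosets H K).

(* Meaningful only when finite_index H K holds. *)
Definition sg_index H K : nat := #|` fset_set (left_cosets H K)|%fset.

End Index.

Section LogDistance.
Variables (R : realType) (b : R) (G : groupType).

Definition log_dist (H K : subgroup G) : \bar R :=
  if `[< finite_index H (H `&` K) /\ finite_index K (H `&` K) >]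
  then (ln (maxn (sg_index H (H `&` K)) (sg_index K (H `&` K)))%:R / ln b)%:E
  else +oo%E.

End LogDistance.

Section LogDistanceTheory.
Variable G : groupType.
Implicit Types H K L : subgroup G.

Lemma subgroup_inj H K : (H : set G) = K -> H = K.
Proof.
case: H K => [H hH] [K hK]/= HK; subst K; congr Subgroup; exact: Prop_irrelevance.
Qed.

Lemma sg1 H : (H : set G) 1%g.
Proof. by case: (subgroup_closed H) => /set_mem. Qed.

Lemma sgV H x : (H : set G) x -> (H : set G) x^-1%g.
Proof.
by move=> /mem_set Hx; apply: set_mem; apply: (group_closedV (subgroup_closed H)).
Qed.

Lemma sgM H x y : (H : set G) x -> (H : set G) y -> (H : set G) (x * y)%g.
Proof.
move=> /mem_set Hx /mem_set Hy; apply: set_mem.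
exact: (group_closedM (subgroup_closed H)).
Qed.

Lemma sgI_closed H K : group_closed [in (H : set G) `&` K].
Proof.
split=> [|x y]; first by apply/mem_set; split; exact: sg1.
by move=> /set_mem[Hx Kx] /set_mem[Hy Ky]; apply/mem_set; split;
  apply: sgM => //; exact: sgV.
Qed.

Definition sgI H K := Subgroup (@sgI_closed H K).

Lemma lcosetE H x :
  [set (x * y)%g | y in (H : set G)] = [set z | (H : set G) (x^-1 * z)%g].
Proof.
apply/seteqP; split => z /=; first by move=> [y Hy <-]; rewrite mulKg.
by move=> Hz; exists (x^-1 * z)%g => //; rewrite mulVKg.
Qed.

Definition covers (s : seq G) H K :=
  forall x, (H : set G) x -> exists2 y, y \in s & (K : set G) (y^-1 * x)%g.

Lemma covers_index s H K : covers s H K ->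
  finite_index H (H `&` K) /\ (sg_index H (H `&` K) <= size s)%N.
Proof.
move=> cov.
pose F (y : G) := [set z | (H : set G) z /\ (K : set G) (y^-1 * z)%g].
have sub : left_cosets H (H `&` K) `<=` [set` [fset F y | y in s]%fset].
  move=> _ [x Hx <-]; have [y ys Ky] := cov x Hx.
  apply/imfsetP; exists y => //=; rewrite (lcosetE (sgI H K)).
  apply/seteqP; split => z /=.
    move=> [Hz Kz]; split; first by rewrite -(mulVKg x z); apply: sgM.
    rewrite -(mulVKg x z) mulgA; exact: sgM.
  move=> [Hz Kz]; split; first by apply: sgM => //; apply: sgV.
  have -> : (x^-1 * z = (y^-1 * x)^-1 * (y^-1 * z))%g.
    by rewrite invgM invgK -mulgA mulVKg.
  by apply: sgM => //; apply: sgV.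
have fin : finite_index H (H `&` K) by apply: sub_finite_set sub _.
split => //; rewrite /sg_index.
apply: (@leq_trans #|` [fset F y | y in s]%fset|%fset).
  apply: fsubset_leq_card; apply/fsubsetP => A.
  by rewrite in_fset_set// => /set_mem/sub.
by rewrite (leq_trans (leq_imfset_card _ _ _))//= size_undup.
Qed.

Lemma index_covers H K : finite_index H (H `&` K) ->
  exists2 s, covers s H K & size s = sg_index H (H `&` K).
Proof.
move=> fin.
pose f (A : set G) : G := xget 1%g A.
exists [seq f A | A <- fset_set (left_cosets H (H `&` K))]; last first.
  by rewrite size_map.
move=> x Hx; set A := [set (x * y)%g | y in (H : set G) `&` K].
exists (f A).
  by apply: map_f; rewrite in_fset_set//; apply/mem_set; exists x.
have : A (f A) by apply: (xgetI 1%g (x := x)); exists 1%g;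
  [split; exact: sg1|rewrite mulg1].
move=> [y [Hy Ky] <-]; rewrite invgM -mulgA mulVg mulg1; exact: sgV.
Qed.

Lemma finite_index_trans H K L :
  finite_index H (H `&` K) -> finite_index K (K `&` L) ->
  finite_index H (H `&` L) /\
  (sg_index H (H `&` L) <= sg_index H (H `&` K) * sg_index K (K `&` L))%N.
Proof.
move=> /index_covers[s cs <-] /index_covers[t ct <-].
rewrite -(size_allpairs (fun x y : G => (x * y)%g)); apply: covers_index.
move=> x /cs[y ys /ct[z zt Lz]]; exists (y * z)%g; first exact: allpairs_f.
by rewrite invgM -mulgA.
Qed.

Lemma index_gt0 H K : finite_index H (H `&` K) -> (0 < sg_index H (H `&` K))%N.
Proof.
move=> fin; rewrite cardfs_gt0; apply/fset0Pn.
exists [set (1 * y)%g | y in (H : set G) `&` K].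
by rewrite in_fset_set//; apply/mem_set; exists 1%g => //; exact: sg1.
Qed.

Lemma index1_sub H K : finite_index H (H `&` K) ->
  (sg_index H (H `&` K) <= 1)%N -> (H : set G) `<=` K.
Proof.
move=> /index_covers[s cs <-]; case: s cs => [|a [|//]] cs _ x Hx.
  by have [] := cs x Hx.
have [_ /[!inE]/eqP-> Kx] := cs x Hx.
have [_ /[!inE]/eqP-> K1] := cs _ (sg1 H).
have -> : (x = (a^-1 * 1)^-1 * (a^-1 * x))%g.
  by rewrite mulg1 invgK mulVKg.
by apply: sgM => //; apply: sgV.
Qed.

Lemma sub_index1 H K : (H : set G) `<=` K ->
  finite_index H (H `&` K) /\ (sg_index H (H `&` K) <= 1)%N.
Proof.
move=> HK; apply: (@covers_index [:: 1%g]) => x Hx.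
by exists 1%g; rewrite ?inE// invg1 mul1g; exact: HK.
Qed.

Variables (R : realType) (b : R).
Variable b_gt1 : 1 < b.

Let lnb_gt0 : 0 < ln b. Proof. exact: ln_gt0. Qed.

Let log_dist_ge0 H K : (0 <= log_dist b H K)%E.
Proof.
rewrite /log_dist; case: asboolP => // -[fH fK].
rewrite lee_fin divr_ge0 ?(ltW lnb_gt0)// ln_ge0// ler1n.
by rewrite leq_max index_gt0.
Qed.

Let log_dist_eq0 H K : log_dist b H K = 0%E <-> H = K.
Proof.
split=> [|<-].
  rewrite /log_dist; case: asboolP => // -[fH fK] [].
  set m := maxn _ _; have m0 : (0 < m)%N by rewrite leq_max index_gt0.
  move=> /eqP; rewrite mulf_eq0 invr_eq0 (gt_eqF lnb_gt0) orbF => /eqP ln0.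
  have m1 : (m <= 1)%N.
    rewrite leqNgt; apply/negP => m1.
    have : 0 < ln (m%:R : R) by rewrite ln_gt0// ltr1n.
    by rewrite ln0 ltxx.
  move: m1; rewrite geq_max => /andP[iH iK].
  apply: subgroup_inj; apply/seteqP; split; first exact: index1_sub.
  by apply: index1_sub; rewrite setIC.
have [fH iH] := @sub_index1 H H (fun _ => id).
rewrite /log_dist; case: asboolP => [_|[]//].
rewrite maxnn; have /eqP -> : sg_index H (H `&` H) == 1%N.
  by rewrite eqn_leq iH index_gt0.
by rewrite ln1 mul0r.
Qed.

Let log_dist_sym H K : log_dist b H K = log_dist b K H.
Proof.
by rewrite /log_dist setIC maxnC; congr (if _ then _ else _);
  apply/asbool_equiv_eq; split => -[].
Qed.

Let log_dist_triangle H K L :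
  (log_dist b H L <= log_dist b H K + log_dist b K L)%E.
Proof.
rewrite {2 3}/log_dist.
case: asboolP => [[fHK fKH]|_]; last first.
  by case: asboolP => _; rewrite ?addye ?leey.
case: asboolP => [[fKL fLK]|_]; last by rewrite addey ?leey.
have [fHL iHL] := finite_index_trans fHK fKL.
rewrite setIC in fLK; rewrite setIC in fKH.
have [fLH iLH] := finite_index_trans fLK fKH.
rewrite /log_dist; case: asboolP => [_|[]]; last by rewrite {2}setIC.
rewrite -EFinD lee_fin -mulrDl ler_pM2r ?invr_gt0// -lnM ?posrE ?ltr0n;
  [|by rewrite leq_max index_gt0..].
rewrite ler_ln ?posrE -?natrM ?ltr0n ?muln_gt0 ?leq_max ?index_gt0// ler_nat.
rewrite geq_max; apply/andP; split.
  by apply: (leq_trans iHL); rewrite leq_mul ?leq_maxl.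
rewrite (setIC H L) (setIC H K) (setIC K L).
by apply: (leq_trans iLH); rewrite mulnC leq_mul ?leq_maxr.
Qed.

Definition log_metric : extended_metric R (subgroup G) :=
  ExtendedMetric log_dist_ge0 log_dist_eq0 log_dist_sym log_dist_triangle.

End LogDistanceTheory.

Definition log_hyperballean (R : realType) (b : R) (b_gt1 : 1 < b)
    (G : groupType) : ballean :=
  metric_ballean (log_metric G b_gt1).

Definition group_isomorphic (G H : groupType) : Prop :=
  exists f : {multiplicative G -> H}, bijective f.

(* The additive group of V, written multiplicatively. *)
Definition mult_of (V : zmodType) : Type := V.

Section MultOf.
Variable V : zmodType.
HB.instance Definition _ := Choice.copy (mult_of V) V.
HB.instance Definition _ := @isGroup.Build (mult_of V)
  (0 : V) (@GRing.opp V) (@GRing.add V)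
  (@addrA V) (@add0r V) (@addr0 V) (@addNr V) (@addrN V).
End MultOf.

Definition Zgroup : groupType := mult_of int.

(* The Prüfer p-group, as the group of all complex roots of unity of order a
   power of p (such roots are algebraic numbers). The condition z != 0 is
   automatic when p is prime; it only makes this a group for every p. *)
Definition p_power_root_of_unity (p : nat) : pred algC :=
  fun z => `[< z != 0 /\ exists n : nat, z ^+ (p ^ n)%N = 1 >].

Record prufer (p : nat) : Type := Prufer {
  prufer_val : algC;
  pruferP : p_power_root_of_unity p prufer_val
}.

Section PruferGroup.
Variable p : nat.

HB.instance Definition _ := [isSub for @prufer_val p].
HB.instance Definition _ := [Choice of prufer p by <:].

Let one_subproof : p_power_root_of_unity p 1.
Proof. by apply/asboolP; split; [exact: oner_neq0|exists 0%N; rewrite expr1n]. Qed.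

Let mul_subproof (x y : prufer p) :
  p_power_root_of_unity p (prufer_val x * prufer_val y).
Proof.
case: x y => [x /asboolP[x0 [m xm]]] [y /asboolP[y0 [n yn]]] /=.
apply/asboolP; split; first by rewrite mulf_neq0.
exists (m + n)%N.
by rewrite exprMn expnD exprM xm expr1n mulnC exprM yn expr1n mulr1.
Qed.

Let inv_subproof (x : prufer p) : p_power_root_of_unity p (prufer_val x)^-1.
Proof.
case: x => [x /asboolP[x0 [m xm]]] /=; apply/asboolP.
by split; [rewrite invr_neq0|exists m; rewrite exprVn xm invr1].
Qed.

Definition prufer_one := Prufer one_subproof.
Definition prufer_mul x y := Prufer (mul_subproof x y).
Definition prufer_inv x := Prufer (inv_subproof x).

Let prufer_mulA : associative prufer_mul.
Proof. by move=> x y z; apply: val_inj; rewrite /= mulrA. Qed.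

Let prufer_mul1 : left_id prufer_one prufer_mul.
Proof. by move=> x; apply: val_inj; rewrite /= mul1r. Qed.

Let prufer_1mul : right_id prufer_one prufer_mul.
Proof. by move=> x; apply: val_inj; rewrite /= mulr1. Qed.

Let prufer_mulV : left_inverse prufer_one prufer_inv prufer_mul.
Proof.
by move=> x; apply: val_inj; case: x => x xP /=; rewrite mulVf//;
  case/asboolP: xP.
Qed.

Let prufer_Vmul : right_inverse prufer_one prufer_inv prufer_mul.
Proof.
by move=> x; apply: val_inj; case: x => x xP /=; rewrite mulfV//;
  case/asboolP: xP.
Qed.

HB.instance Definition _ := @isGroup.Build (prufer p)
  prufer_one prufer_inv prufer_mul prufer_mulA prufer_mul1 prufer_1mul
  prufer_mulV prufer_Vmul.

End PruferGroup.

(* Main.v *)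
From HB Require Import structures.
Require Import Defs.
From mathcomp Require Import all_boot all_order all_algebra reals.
From mathcomp Require Import boolp classical_sets functions cardinality.
From mathcomp Require Import ereal interval_inference sequences exp.
From mathcomp Require Import algC cyclotomic.
From mathcomp Require Import zify.

(** Forget the logarithm: an asymorphism between logarithmic hyperballeans is a
    bijection f between the sets of subgroups such that, for each n, mutual
    covering by n cosets is turned into mutual covering by m cosets for some m
    depending on n only, and likewise for the inverse of f (asymorphicP). In
    particular f preserves the classes of commensurability and the finiteness
    of balls.

    The integers and the Prüfer groups share two such invariants. Their
    subgroups form exactly two commensurability classes, one of which is a
    single point, and their balls are finite. Conversely, let G have both
    properties. The trivial subgroup and G are not commensurable, for otherwise
    G would be finite and there would be one class only; so one of them is the
    isolated point.

    If the trivial subgroup is isolated, G is torsion-free and its nontrivial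
    subgroups have finite index. Then G has an infinite cyclic central subgroup
    of finite index, the transfer embeds G into the integers, and G is
    isomorphic to the integers (isolated_triv).

    If G is isolated, its proper subgroups are finite. Since balls are finite,
    G has finitely many elements of each order; as G has no proper subgroup of
    finite index, centralizers are everything, G is abelian, then divisible,
    and it is exhausted by a chain of successive q-th roots for a prime q,
    which characterises the Prüfer q-group (isolated_full).

    It remains to tell the hyperballean of the integers from those of the Prüfer
    groups, and to see that the latter are all alike. The subgroups of the
    Prüfer p-group are the whole group and those of order p ^ n, with covering
    number p ^ |m - n|: up to constants this is an isolated point and the half-line of natural numbers,
    whatever p is (prufer_model). The half-line grows linearly, while the
    subgroups generated by 2 ^ a * 3 ^ b contain a quarter-plane, which grows
    quadratically (no_option_nat_embedding). *)

Set Implicit Arguments.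
Unset Strict Implicit.
Unset Printing Implicit Defensive.
Import Order.TTheory GRing.Theory Num.Theory.
Local Open Scope classical_set_scope.
Local Open Scope group_scope.

Local Notation "x '\insg' H" := (subgroup_set H x) (at level 70).

(** * Commensurability replaces the logarithmic distance *)

(** The log-distance between H and K is at most log n exactly when each of
    them is covered by at most n cosets of the other; unlike an index, a
    covering list makes sense without a proof of finiteness. *)
Definition commens (n : nat) (G : groupType) (H K : subgroup G) : Prop :=
  (exists2 s, covers s H K & (size s <= n)%N) /\
  (exists2 s, covers s K H & (size s <= n)%N).

Definition commens_bounded (G G' : groupType)
    (f : subgroup G -> subgroup G') : Prop :=
  forall n, exists m, forall H K, commens n H K -> commens m (f H) (f K).

(** This is asymorphy of the logarithmic hyperballeans, freed from the base
    of the logarithm: see asymorphicP. *)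
Definition coarse_equiv (G G' : groupType) : Prop :=
  exists (f : subgroup G -> subgroup G') (g : subgroup G' -> subgroup G),
    [/\ cancel f g, cancel g f, commens_bounded f & commens_bounded g].

Section Commens.
Variable G : groupType.
Implicit Types H K L : subgroup G.

Lemma subgroupP H K : (forall x, x \insg H <-> x \insg K) -> H = K.
Proof.
by move=> HK; apply: subgroup_inj; apply/funext => x; apply/propext.
Qed.

Lemma sgX H x n : x \insg H -> (x ^+ n) \insg H.
Proof.
move=> Hx; elim: n => [|n IH]; first by rewrite expg0; exact: sg1.
by rewrite expgS; apply: sgM.
Qed.

Lemma commens_sym n H K : commens n H K -> commens n K H.
Proof. by case. Qed.

Lemma commens_le m n H K : (m <= n)%N -> commens m H K -> commens n H K.
Proof.
move=> mn [[s cs sm] [t ct tm]].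
by split; [exists s|exists t] => //; apply: leq_trans mn.
Qed.

Lemma covers_sub H K : (forall x, x \insg H -> x \insg K) -> covers [:: 1] H K.
Proof.
by move=> HK x Hx; exists 1; rewrite ?inE// invg1 mul1g; exact: HK.
Qed.

(** Between nested subgroups only one of the two coverings is at stake; a
    covering list is never empty because 1 has to be covered. *)
Lemma commens_sub H K n s : (forall x, x \insg H -> x \insg K) ->
  covers s K H -> (size s <= n)%N -> commens n H K.
Proof.
move=> HK cs sn; split; last by exists s.
exists [:: 1]; first exact: covers_sub.
apply: leq_trans sn => /=; case: s cs => // /(_ 1 (sg1 K))[]//.
Qed.

Lemma finite_indexP H K n :
  (finite_index H ((H : set G) `&` K) /\
   (sg_index H ((H : set G) `&` K) <= n)%N) <->
  exists2 s, covers s H K & (size s <= n)%N.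
Proof.
split=> [[/index_covers[s cs <-] sn]|[s /covers_index[fin sn] le]].
  by exists s.
by split=> //; apply: leq_trans le.
Qed.

End Commens.

Section Translation.
Variables (R : realType) (b : R) (b_gt1 : (1 < b)%R).

Let lnb_gt0 : (0 < ln b)%R. Proof. exact: ln_gt0. Qed.

(** The successor keeps the argument of the logarithm positive. *)
Lemma log_dist_le (G : groupType) (H K : subgroup G) n :
  (log_dist b H K <= (ln n.+1%:R / ln b)%:E)%E <-> commens n.+1 H K.
Proof.
rewrite /log_dist; case: asboolP => [[fH fK]|nfin].
  rewrite lee_fin ler_pM2r ?invr_gt0// ler_ln ?posrE ?ltr0n//; last first.
    by rewrite leq_max index_gt0.
  rewrite ler_nat geq_max; split=> [/andP[iH iK]|[cH cK]].
    split; apply/finite_indexP; first by [].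
    by rewrite setIC.
  move/finite_indexP: cH => [_ ->].
  by move/finite_indexP: cK; rewrite setIC => -[_ ->].
split=> [|[cH cK]]; first by rewrite leye_eq.
case: nfin; split; first by case/finite_indexP: cH.
by rewrite setIC; case/finite_indexP: cK.
Qed.

Lemma radius_le_log (r : R) : exists n, (r <= ln n.+1%:R / ln b)%R.
Proof.
exists (Num.truncn (expR (r * ln b))).
rewrite ler_pdivlMr// -[X in (X <= _)%R]expRK ler_ln ?posrE ?expR_gt0 ?ltr0n//.
by apply/ltW; exact: truncnS_gt.
Qed.

Lemma log_radius_ge0 n : (0 <= ln n.+1%:R / ln b)%R.
Proof. by rewrite divr_ge0 ?(ltW lnb_gt0)// ln_ge0// ler1n. Qed.

Lemma bornologousP (G G' : groupType) (f : subgroup G -> subgroup G') :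
  @bornologous (log_hyperballean b_gt1 G) (log_hyperballean b_gt1 G') f <->
  commens_bounded f.
Proof.
split=> [bf n|bf [r r0]].
  have [[r r0] /= hr] := bf (NngNum (log_radius_ge0 n)).
  have [m rm] := radius_le_log r.
  exists m.+1 => H K /(@commens_le _ _ n.+1 _ _ (leqnSn n))/log_dist_le HK.
  have : [set f x | x in closed_eball (log_metric G b_gt1) H
     (NngNum (log_radius_ge0 n))] (f K) by exists K.
  move=> /hr/= le; apply/log_dist_le; apply: le_trans le _.
  by rewrite lee_fin.
have [n rn] := radius_le_log r.
have [m hm] := bf n.+1.
exists (NngNum (log_radius_ge0 m)) => H _ [K HK <-] /=.
apply/log_dist_le; apply: (@commens_le _ m) => //.
apply/hm/log_dist_le; apply: le_trans HK _.
by rewrite lee_fin.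
Qed.

Lemma asymorphicP (G G' : groupType) :
  asymorphic (log_hyperballean b_gt1 G) (log_hyperballean b_gt1 G') <->
  coarse_equiv G G'.
Proof.
split=> [[f [g [fg gf /bornologousP bf /bornologousP bg]]]|].
  by exists f, g.
by move=> [f [g [fg gf bf bg]]]; exists f, g; split=> //; apply/bornologousP.
Qed.

End Translation.

Lemma coarse_equiv_sym G G' : coarse_equiv G G' -> coarse_equiv G' G.
Proof. by move=> [f [g [fg gf bf bg]]]; exists g, f. Qed.

Lemma coarse_equiv_trans G1 G2 G3 :
  coarse_equiv G1 G2 -> coarse_equiv G2 G3 -> coarse_equiv G1 G3.
Proof.
have comp A B C (f : subgroup A -> subgroup B) (g : subgroup B -> subgroup C) :
    commens_bounded f -> commens_bounded g -> commens_bounded (g \o f).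
  move=> bf bg n; have [m hm] := bf n; have [k hk] := bg m.
  by exists k => H K /hm/hk.
move=> [f [f' [ff' f'f bf bf']]] [g [g' [gg' g'g bg bg']]].
exists (g \o f), (f' \o g'); split; try exact: comp.
- exact: can_comp gg' ff'.
- exact: can_comp f'f g'g.
Qed.

(** * Isomorphisms *)

Lemma group_isomorphicP (G G' : groupType) (f : G -> G') :
  {morph f : x y / x * y} -> bijective f -> group_isomorphic G G'.
Proof.
move=> fM bf.
pose F := @isMultiplicative.Build G G' f fM.
by exists (HB.pack_for {multiplicative G -> G'} f F).
Qed.

Lemma group_isomorphic_sym G G' :
  group_isomorphic G G' -> group_isomorphic G' G.
Proof.
move=> [f [g fg gf]]; apply: (@group_isomorphicP _ _ g); last by exists f.
exact: can2_gmulfM fg gf.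
Qed.

Section Preimage.
Variables (G G' : groupType) (f : {multiplicative G -> G'}).

Lemma multiplicative1 : f 1 = 1.
Proof. by apply: (@mulgI _ (f 1)); rewrite -gmulfM !mulg1. Qed.

Lemma multiplicativeV x : f x^-1 = (f x)^-1.
Proof.
by apply: (@mulgI _ (f x)); rewrite -gmulfM !mulgV multiplicative1.
Qed.

Lemma preim_closed (H : subgroup G') : group_closed [in f @^-1` (H : set G')].
Proof.
split=> [|x y]; first by apply/mem_set; rewrite /= multiplicative1; exact: sg1.
move=> /set_mem/= Hx /set_mem/= Hy; apply/mem_set => /=.
by rewrite gmulfM multiplicativeV; apply: sgM => //; exact: sgV.
Qed.

Definition sg_preim H := Subgroup (@preim_closed H).

End Preimage.

(** Taking preimages under an isomorphism preserves all covering numbers. *)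
Lemma coarse_equiv_iso G G' : group_isomorphic G G' -> coarse_equiv G G'.
Proof.
move=> iso; have [f [g fg gf]] := iso.
have gM := can2_gmulfM fg gf.
pose g' := HB.pack_for {multiplicative G' -> G} g
  (@isMultiplicative.Build G' G g gM).
have bnd (A B : groupType) (u : {multiplicative A -> B}) v : cancel u v -> cancel v u ->
    commens_bounded (sg_preim u).
  move=> uv vu n; exists n => H K.
  have half H' K' : (exists2 s, covers s H' K' & (size s <= n)%N) ->
      exists2 s, covers s (sg_preim u H') (sg_preim u K') & (size s <= n)%N.
    move=> [s cs sn]; exists (map v s); last by rewrite size_map.
    move=> x /= /cs[y ys Ky]; exists (v y); first exact: map_f.
    by rewrite /= gmulfM multiplicativeV vu.
  by move=> [HK KH]; split; apply: half.
exists (sg_preim g'), (sg_preim f); split.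
- by move=> H; apply: subgroupP => x /=; rewrite fg.
- by move=> H; apply: subgroupP => x /=; rewrite gf.
- exact: (bnd _ _ g' f).
- exact: (bnd _ _ f g).
Qed.

(** * Cyclic subgroups *)

Section Cyclic.
Variable G : groupType.
Implicit Types (x y : G) (H K : subgroup G).

Definition zpow x (k : int) : G :=
  match k with Posz n => x ^+ n | Negz n => x ^- n.+1 end.

(** Writing integers as differences of naturals makes the power law a
    computation with natural exponents. *)
Lemma zpowB x m n : zpow x (m%:Z - n%:Z)%R = x ^+ m / x ^+ n.
Proof.
have [nm|mn] := leqP n m; first by rewrite subzn //= expgnFr.
have -> : (m%:Z - n%:Z)%R = Negz (n - m).-1 by lia.
rewrite /zpow prednK ?subn_gt0// -[in RHS](subnK (ltnW mn)) expgnDr invgM.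
by rewrite mulgA mulgV mul1g.
Qed.

Lemma int_diffP (k : int) : exists m n : nat, k = (m%:Z - n%:Z)%R.
Proof.
by case: k => n; [exists n, 0%N|exists 0%N, n.+1]; lia.
Qed.

Lemma zpowD x k l : zpow x (k + l)%R = zpow x k * zpow x l.
Proof.
have [m [n ->]] := int_diffP k; have [m' [n' ->]] := int_diffP l.
have -> : (m%:Z - n%:Z + (m'%:Z - n'%:Z) = (m + m')%N%:Z - (n + n')%N%:Z)%R.
  by lia.
rewrite !zpowB !expgnDr invgM -!mulgA; congr (_ * _); rewrite !mulgA.
have xx i j : commute (x ^+ i) (x ^+ j) by apply: commuteX2.
have xnV i : commute (x ^- n) (x ^+ i) by apply/commute_sym/commuteV.
by rewrite -(mulgA (x ^- n)); apply/commute_sym/commuteM; [|apply: commuteV].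
Qed.

Lemma zpow1 x : zpow x 1 = x. Proof. exact: expg1. Qed.

Lemma zpowN x k : zpow x (- k)%R = (zpow x k)^-1.
Proof. by apply: (@mulgI _ (zpow x k)); rewrite -zpowD subrr mulgV. Qed.

Lemma zpowX x n k : zpow (x ^+ n) k = zpow x (n%:Z * k)%R.
Proof.
have [m [l ->]] := int_diffP k.
by rewrite mulrBr -!PoszM !zpowB !expgnA.
Qed.

Lemma zpow_inj x : (forall n, x ^+ n.+1 <> 1) -> injective (zpow x).
Proof.
move=> inf k l kl; have /eqP : zpow x (k - l)%R = 1.
  by rewrite zpowD zpowN kl mulgV.
move=> kl1; apply/eqP; rewrite -subr_eq0; apply/eqP; move: kl1.
case: (k - l)%R => [[//|n]|n] /eqP; first by move/inf.
by move/eqP; rewrite invg_eq1 => /eqP/inf.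
Qed.

Lemma cyc_closed x : group_closed [in [set zpow x k | k in [set: int]]].
Proof.
split=> [|_ _ /set_mem[k _ <-] /set_mem[l _ <-]]; apply/mem_set.
  by exists 0%R.
by exists (k - l)%R => //; rewrite zpowD zpowN.
Qed.

Definition cyc x : subgroup G := Subgroup (@cyc_closed x).

Lemma cycP x y : y \insg cyc x <-> exists k, y = zpow x k.
Proof. by split=> [[k _ <-]|[k ->]]; exists k. Qed.

Lemma cyc_gen x : x \insg cyc x.
Proof. by apply/cycP; exists 1%R; rewrite zpow1. Qed.

Lemma sg_zpow H x k : x \insg H -> zpow x k \insg H.
Proof. by move=> Hx; case: k => n; [|apply: sgV]; exact: sgX. Qed.

Lemma sub_cyc H x : x \insg H -> forall y, y \insg cyc x -> y \insg H.
Proof. by move=> Hx _ /cycP[k ->]; exact: sg_zpow. Qed.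

Lemma cyc_commute x y z : commute y x -> z \insg cyc x -> commute y z.
Proof.
move=> yx /cycP[[n|n] ->]; [|apply: commuteV]; exact: commuteX.
Qed.

Lemma cyc_finP x N : x ^+ N.+1 = 1 ->
  forall y, y \insg cyc x -> exists2 k, (k < N.+1)%N & y = x ^+ k.
Proof.
move=> x1 _ /cycP[k ->].
exists (absz (k %% N.+1%:Z)%Z); first by lia.
have {1}-> : k = (N.+1%:Z * (k %/ N.+1%:Z)%Z + absz (k %% N.+1%:Z)%Z)%R by lia.
rewrite zpowD -[RHS]mul1g; congr (_ * _).
have [m [n ->]] := int_diffP (k %/ N.+1%:Z)%Z.
by rewrite mulrBr zpowB !expgnA x1 !expg1n divg1.
Qed.

(** The inverse of k |-> x ^ k exists because the powers of x are
    distinct and exhaust G. *)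
Lemma zpow_isomorphic x : (forall n, x ^+ n.+1 <> 1) ->
  (forall y, y \insg cyc x) -> group_isomorphic G Zgroup.
Proof.
move=> inf gen; apply: group_isomorphic_sym.
apply: (@group_isomorphicP Zgroup G (zpow x)).
  by move=> k l; rewrite [(k * l)%g]/(k + l)%R zpowD.
have /choice[e eE] y := (cycP x y).1 (gen y).
exists e => [k|y]; last by rewrite -eE.
by apply: (zpow_inj inf); rewrite -eE.
Qed.

(** * Pigeonhole on cosets *)

(** This is how every index bound is exploited below: n + 1 elements lying in
    n cosets must have two in a common coset. *)
Lemma covers_pigeonhole H K s n (u : nat -> G) : covers s H K ->
  (size s <= n)%N -> (forall i, (i <= n)%N -> u i \insg H) ->
  exists i j, [/\ (i < j)%N, (j <= n)%N & ((u i)^-1 * u j) \insg K].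
Proof.
move=> cs sn uH.
have /choice[h hP] (i : 'I_n.+1) : exists k : 'I_(size s),
    ((nth 1 s k)^-1 * u i) \insg K.
  have [|y ys Ky] := cs (u i); first by apply: uH; rewrite -ltnS.
  have ys' : (index y s < size s)%N by rewrite index_mem.
  by exists (Ordinal ys'); rewrite /= nth_index.
have /injectivePn[i [j ij hij]] : ~~ injectiveb h.
  apply/negP => /injectiveP/leq_card; rewrite !card_ord => le.
  by move: (leq_trans le sn); rewrite ltnn.
have same (a c : 'I_n.+1) : h a = h c -> ((u a)^-1 * u c) \insg K.
  move=> ac; have := sgM (sgV (hP a)) (hP c).
  by rewrite invgM invgK ac -mulgA mulVKg.
have [lt|gt|/val_inj e] := ltngtP i j; last by rewrite e eqxx in ij.
- by exists i, j; split=> //; [rewrite -ltnS|exact: same].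
- by exists j, i; split=> //; [rewrite -ltnS|exact: same].
Qed.

Lemma commens_cyc_pow x n : (0 < n)%N -> commens n (cyc (x ^+ n)) (cyc x).
Proof.
move=> n0; apply: (@commens_sub _ _ _ _ [seq x ^+ i | i <- iota 0 n]).
- by apply: sub_cyc; apply: sgX; exact: cyc_gen.
- move=> _ /cycP[k ->]; pose r := absz (k %% n%:Z)%Z.
  exists (x ^+ r).
    by apply: (map_f (fun i => x ^+ i)); rewrite mem_iota /r; lia.
  apply/cycP; exists (k %/ n%:Z)%Z; rewrite zpowX.
  have {1}-> : k = (r%:Z + n%:Z * (k %/ n%:Z)%Z)%R by rewrite /r; lia.
  by rewrite zpowD mulKg.
- by rewrite size_map size_iota.
Qed.

(** Pigeonhole applied to the powers 1, x, ..., x ^ n. *)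
Lemma pow_in_covered H K s x n : covers s H K -> (size s <= n)%N ->
  x \insg H -> exists k, [/\ (0 < k)%N, (k <= n)%N & (x ^+ k) \insg K].
Proof.
move=> cs sn Hx.
have [|i [j [ij jn Kij]]] := covers_pigeonhole (u := fun i => x ^+ i) cs sn.
  by move=> i _; exact: sgX.
exists (j - i)%N; split; rewrite ?subn_gt0//; first by lia.
move: Kij; rewrite -{1}(subnKC (ltnW ij)) expgnDr mulKg//.
Qed.

(** * The trivial subgroup and the whole group *)

Lemma triv_closed : group_closed [in [set 1 : G]].
Proof.
split=> [|x y /set_mem/= -> /set_mem/= ->]; apply/mem_set => //=.
by rewrite mulgV.
Qed.

Definition sg_triv : subgroup G := Subgroup triv_closed.

Lemma full_closed : group_closed [in [set: G]].
Proof. by split=> [|x y _ _]; apply/mem_set. Qed.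

Definition sg_full : subgroup G := Subgroup full_closed.

Lemma covers_triv s H : covers s H sg_triv -> forall x, x \insg H -> x \in s.
Proof.
move=> cs x /cs[y ys /= yx]; suff -> : x = y by [].
by rewrite -(mulVKg y x) yx mulg1.
Qed.

Lemma covers_all s H K : (forall x, x \insg H -> x \in s) -> covers s H K.
Proof.
by move=> Hs x /Hs xs; exists x => //; rewrite mulVg; exact: sg1.
Qed.

Lemma commens_triv s H n : (forall x, x \insg H -> x \in s) ->
  (size s <= n)%N -> commens n sg_triv H.
Proof.
move=> Hs sn; apply: (@commens_sub _ _ _ _ s) => //; last exact: covers_all.
by move=> x /= ->; exact: sg1.
Qed.

Lemma commens_cyc_fin x n : x ^+ n.+1 = 1 -> commens n.+1 sg_triv (cyc x).
Proof.
move=> x1; apply: (@commens_triv [seq x ^+ i | i <- iota 0 n.+1]).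
  move=> y /(cyc_finP x1)[k kn ->]; apply: (map_f (fun i => x ^+ i)).
  by rewrite mem_iota.
by rewrite size_map size_iota.
Qed.

Lemma neq_sg_triv H : H <> sg_triv -> exists2 x, x \insg H & x <> 1.
Proof.
move=> HT; apply: contrapT => no; apply: HT; apply: subgroupP => x.
split=> [Hx|/= ->]; last exact: sg1.
by apply: contrapT => /= x1; apply: no; exists x.
Qed.

Lemma neq_sg_full H : H <> sg_full -> exists x, ~ x \insg H.
Proof.
move=> HT; apply: contrapT => no; apply: HT; apply: subgroupP => x.
by split=> // _; apply: contrapT => nx; apply: no; exists x.
Qed.

End Cyclic.

(** * Torsion-free groups with all nontrivial subgroups of finite index *)

(** H is a one-point component and all other subgroups form a second
    component. In the two target groups the isolated point is the trivial
    subgroup (integers) and the whole group (Prüfer group); leaving H arbitrary makes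
    its existence a coarse invariant. *)
Definition isolated (G : groupType) (H : subgroup G) : Prop :=
  [/\ exists K, K <> H,
      forall n K, commens n H K -> K = H &
      forall K L, K <> H -> L <> H -> exists n, commens n K L].

Section Transfer.
Variable G : groupType.
Implicit Types (x y z : G) (s t : seq G).

(** A system of representatives as a duplicate-free list: choosing by the
    coset itself makes the representative function r constant on cosets, and
    T consists of its fixed points. *)
Lemma coset_reps t (C : subgroup G) : covers t (sg_full G) C ->
  exists (r : G -> G) (T : seq G),
    [/\ forall x, ((r x)^-1 * x) \insg C,
        forall x y, (x^-1 * y) \insg C -> r x = r y,
        uniq T & forall x, (x \in T) <-> (r x = x)].
Proof.
move=> ct; pose r x := xget 1 [set w | (x^-1 * w) \insg C].
have rP x : (x^-1 * r x) \insg C.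
  apply: (@xgetPex _ 1 [set w | (x^-1 * w) \insg C]).
  by exists x => /=; rewrite mulVg; exact: sg1.
have rV x : ((r x)^-1 * x) \insg C by rewrite -[x in _ * x]invgK -invgM; exact: sgV.
have req x y : (x^-1 * y) \insg C -> r x = r y.
  move=> xy; congr xget; apply/funext => w; apply/propext => /=; split=> hw.
    have -> : y^-1 * w = (x^-1 * y)^-1 * (x^-1 * w).
      by rewrite invgM invgK -mulgA mulVKg.
    by apply: sgM => //; exact: sgV.
  have -> : x^-1 * w = (x^-1 * y) * (y^-1 * w) by rewrite -mulgA mulVKg.
  exact: sgM.
exists r, (undup (map r t)); split=> //; first exact: undup_uniq.
move=> x; rewrite mem_undup; split=> [/mapP[y yt ->]|rx].
  by apply/esym/req.
have [//|y yt yx] := ct x; rewrite -rx -(req _ _ yx); exact: map_f.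
Qed.

(** The transfer homomorphism into the infinite cyclic group C generated by
    z. If r picks representatives of the cosets x C and x = r x * z ^ e x,
    then V x is the sum of e (x * y) over the representatives y. Left
    multiplication by an element permutes the cosets, which makes V additive;
    as z is central, V z is the index of C, hence positive. *)
Lemma transfer z t : (forall n, z ^+ n.+1 <> 1) ->
  (forall y, commute y z) -> covers t (sg_full G) (cyc z) ->
  exists2 V : G -> int, forall x y, V (x * y) = (V x + V y)%R &
    (0 < V z)%R.
Proof.
move=> inf zC ct; have [r [T [rV req uT TP]]] := coset_reps ct.
have /choice[e eP] x : exists k, x = r x * zpow z k.
  by have /cycP[k kP] := rV x; exists k; rewrite -kP mulVKg.
have eU x k : x = r x * zpow z k -> e x = k.
  by move=> xk; apply: (zpow_inj inf); apply: (@mulgI _ (r x)); rewrite -eP.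
have rr x : r (r x) = r x by apply: req.
have e_mul h y : e (h * y) = (e (h * r y)%g + e y)%R.
  apply: eU; rewrite zpowD mulgA.
  have -> : r (h * y) = r (h * r y).
    by apply/esym/req; rewrite invgM -mulgA mulKg.
  by rewrite -eP -mulgA -eP.
exists (fun x => \sum_(y <- T) e (x * y)%g)%R => [x h|].
  have permT : perm_eq [seq r (h * y) | y <- T] T.
    have uT' : uniq [seq r (h * y) | y <- T].
      rewrite map_inj_in_uniq// => y y' /TP yT /TP y'T eqr.
      rewrite -yT -y'T; apply: req.
      have := sgM (sgV (rV (h * y))) (rV (h * y')).
      by rewrite eqr !invgM invgK -!mulgA mulVKg mulKg.
    have sub : {subset [seq r (h * y) | y <- T] <= T}.
      by move=> _ /mapP[y _ ->]; apply/TP.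
    apply: uniq_perm => //; apply: (uniq_min_size uT' sub _).2.
    by rewrite size_map.
  have -> : (\sum_(y <- T) e (x * y)%g =
             \sum_(y <- T) e (x * r (h * y))%g)%R.
    by rewrite -(perm_big _ permT) big_map.
  rewrite -big_split /=.
  by apply: eq_bigr => y _; rewrite -mulgA; exact: e_mul.
have eT y : y \in T -> e (z * y) = 1%R.
  move=> /TP yT; apply: eU; rewrite zpow1 -zC; congr (_ * _).
  rewrite -[LHS]yT; apply: req; rewrite mulKg; exact: cyc_gen.
rewrite big_seq (eq_bigr (fun=> 1%R)) => [|y /eT//]; rewrite -big_seq.
rewrite big_const_seq count_predT iter_addr_0.
case: T TP {uT eT} => [TP|]; last by move=> a l _; rewrite ltr0n.
by have := (TP (r 1)).2 (rr 1); rewrite inE.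
Qed.

Lemma additive_zpow (V : G -> int) x k :
  (forall x y, V (x * y) = (V x + V y)%R) -> V (zpow x k) = (V x * k)%R.
Proof.
move=> VM.
have V1 : V 1 = 0%R by apply: (@addrI _ (V 1)); rewrite -VM mulg1 addr0.
have VX n : V (x ^+ n) = (V x * n%:Z)%R.
  elim: n => [|n IH]; first by rewrite expg0 V1 mulr0.
  by rewrite expgS VM IH; lia.
have [m [n ->]] := int_diffP k; apply: (@addIr _ (V (x ^+ n))).
by rewrite zpowB -VM mulgVK !VX; lia.
Qed.

(** Division with remainder by the least positive value of V. *)
Lemma int_embedding_cyclic (V : G -> int) x0 :
  (forall x y, V (x * y) = (V x + V y)%R) -> (forall x, V x = 0%R -> x = 1) ->
  (0 < V x0)%R -> exists x, forall y, y \insg cyc x.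
Proof.
move=> VM Vinj V0.
have exd : exists n, `[< exists x, V x = Posz n.+1 >].
  by exists (absz (V x0)).-1; apply/asboolP; exists x0; lia.
have [d /asboolP[x xd] dmin] := ex_minnP exd.
exists x => y; apply/cycP; exists (V y %/ d.+1%:Z)%Z.
set q := (_ %/ _)%Z; pose w := y * zpow x (- q)%R.
have wV : V w = (V y %% d.+1%:Z)%Z by rewrite VM additive_zpow// xd /q; lia.
have w0 : V w = 0%R.
  apply: contrapT => /eqP w0.
  have : (d <= (absz (V w)).-1)%N.
    by apply: dmin; apply/asboolP; exists w; lia.
  lia.
have := Vinj _ w0; rewrite /w zpowN => /eqP; rewrite divg_eq1 => /eqP//.
Qed.

(** All nontrivial subgroups have finite index and G is torsion-free, since
    a finite subgroup is close to the trivial one. Any two nontrivial cyclic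
    subgroups intersect nontrivially, so a power z of a fixed x commutes with
    the finitely many coset representatives of the group generated by x, hence
    z is central. The transfer to the group generated by z has trivial kernel:
    it is positive at z, and every nontrivial element has a power equal to a
    nontrivial power of z. *)
Lemma isolated_triv : isolated (sg_triv G) -> group_isomorphic G Zgroup.
Proof.
move=> [[H0 H0T] iso conn].
have tf x n : x ^+ n.+1 = 1 -> x = 1.
  move=> /commens_cyc_fin/iso cT.
  by have : x \insg sg_triv G by rewrite -cT; exact: cyc_gen.
have cycT x : x <> 1 -> cyc x <> sg_triv G.
  by move=> x1 cT; apply: x1; have := cyc_gen x; rewrite cT.
have [x _ x1] := neq_sg_triv H0T.
have fullT : sg_full G <> sg_triv G.
  by move=> fT; apply: x1; have : x \insg sg_full G by []; rewrite fT.
have fin y : y <> 1 -> exists s, covers s (sg_full G) (cyc y).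
  move=> y1; have [n [[s cs _] _]] := conn _ _ fullT (cycT _ y1).
  by exists s.
have pow y w : y <> 1 -> exists2 k, (0 < k)%N & (w ^+ k) \insg cyc y.
  move=> /fin[s cs]; have [//|k [k0 _ wk]] := pow_in_covered cs (leqnn _) (_ : w \insg sg_full G).
  by exists k.
have [s cs] := fin x x1.
have [N N0 sN] : exists2 N, (0 < N)%N & forall y, y \in s -> commute y (x ^+ N).
  elim: s {cs} => [|y s [N N0 sN]]; first by exists 1%N.
  have [k k0 yk] : exists2 k, (0 < k)%N & commute y (x ^+ k).
    have [->|y1] := pselect (y = 1).
      by exists 1%N => //; apply/commute_sym/commute1.
    have [k k0 xk] := pow y x y1; exists k => //.
    by apply: cyc_commute xk; exact: commute_refl.
  exists (k * N)%N; first by rewrite muln_gt0 k0.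
  move=> w /[!inE]/orP[/eqP->|/sN wN]; first by rewrite expgnA; exact: commuteX.
  by rewrite mulnC expgnA; exact: commuteX.
pose z := x ^+ N.
have z1 : z <> 1 by rewrite /z; case: N N0 {sN z} => // n _ /tf.
have zinf n : z ^+ n.+1 <> 1 by move/tf.
have zC y : commute y z.
  have [//|w ws wy] := cs y; rewrite -(mulVKg w y); apply: commute_sym.
  apply: commuteM; apply: commute_sym; first exact: sN.
  apply/commute_sym/(cyc_commute _ wy).
  by apply/commute_sym/commuteX/commute_refl.
have [t ct] := fin z z1.
have [V VM Vz] := transfer zinf zC ct.
have Vinj y : V y = 0%R -> y = 1.
  move=> Vy; apply: contrapT => y1.
  have [k k0 /cycP[l zl]] := pow _ z y1.
  have : V (zpow z k%:Z) = 0%R.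
    by rewrite [zpow z _]zl additive_zpow// Vy mul0r.
  by rewrite additive_zpow//; nia.
have [g gen] := int_embedding_cyclic VM Vinj Vz.
apply: (@zpow_isomorphic _ g) => // n /tf g1; apply: z1.
by have /cycP[k ->] := gen z; rewrite g1; case: k => m /=; rewrite expg1n ?invg1.
Qed.

End Transfer.

(** * Groups generated by a Prüfer chain *)

Section PruferChain.
Variables (q : nat) (q_prime : prime q).

(** x n is an element of order q ^ n; the chain determines the subgroup that
    it generates up to isomorphism. *)
Definition prufer_chain (G : groupType) (x : nat -> G) : Prop :=
  [/\ x 0%N = 1, x 1%N <> 1 & forall n, x n.+1 ^+ q = x n].

Definition chain_generates (G : groupType) (x : nat -> G) : Prop :=
  forall y, exists n k, y = x n ^+ k.

Section Chain.
Variables (G : groupType) (x : nat -> G) (xP : prufer_chain x).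

Lemma chain_shift n m : x (n + m)%N ^+ (q ^ m) = x n.
Proof.
case: xP => _ _ xS; elim: m => [|m IH]; first by rewrite addn0 expg1.
by rewrite addnS expnS expgnA xS IH.
Qed.

(** If x n.+1 ^ k = 1 then q ^ n divides k by induction, and the quotient j
    satisfies x 1 ^ j = 1, where x 1 has prime order q. *)
Lemma chain_order n k : x n ^+ k = 1 <-> (q ^ n %| k)%N.
Proof.
case: (xP) => x0 x1 xS; split=> [|/dvdnP[j ->]]; last first.
  by rewrite mulnC expgnA -[n in x n]add0n chain_shift x0 expg1n.
elim: n => [|n IH] xk; first by rewrite expn0 dvd1n.
have /dvdnP[j kj] : (q ^ n %| k)%N.
  by apply: IH; rewrite -xS expgnAC xk expg1n.
have x1j : x 1%N ^+ j = 1.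
  by rewrite -(chain_shift 1 n) -expgnA mulnC -kj add1n.
rewrite kj expnS dvdn_mul//; apply: contrapT => /negP.
rewrite -prime_coprime// => /(coprimeP _ (prime_gt0 q_prime))[[u v] /= uv].
apply: x1; have : x 1%N ^+ (u * q - v * j) = 1.
  rewrite expgnFr; last by lia.
  by rewrite [(u * q)%N]mulnC [(v * j)%N]mulnC !expgnA x1j xS x0 !expg1n mulgV.
by rewrite uv.
Qed.

Lemma chain_eq n k l : x n ^+ k = x n ^+ l <-> k = l %[mod (q ^ n)%N].
Proof.
wlog kl : k l / (k <= l)%N.
  move=> H; have [/H//|/ltnW/H[h1 h2]] := leqP k l.
  by split=> /esym; [move/h1|move/h2].
have -> : (k = l %[mod (q ^ n)%N]) <-> q ^ n %| (l - k)%N.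
  by rewrite -eqn_mod_dvd//; split=> [->|/eqP->].
rewrite -chain_order -[in X in X <-> _](subnK kl) expgnDr; split=> [e|->].
  by apply: (@mulIg _ (x n ^+ k)); rewrite mul1g -e.
by rewrite mul1g.
Qed.

Lemma chain_level n m k : x n ^+ k = x (n + m)%N ^+ (q ^ m * k).
Proof. by rewrite expgnA chain_shift. Qed.

Hypothesis gen : chain_generates x.

Lemma chain_common y z : exists n k l, y = x n ^+ k /\ z = x n ^+ l.
Proof.
have [n [k ->]] := gen y; have [m [l ->]] := gen z.
exists (n + m)%N, (q ^ m * k)%N, (q ^ n * l)%N.
by rewrite -chain_level addnC -chain_level.
Qed.

End Chain.

(** The map x n ^ k |-> x' n ^ k is well defined and injective because
    equality of two powers depends only on the exponents modulo q ^ n. *)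
Lemma chain_isomorphic (G G' : groupType) (x : nat -> G) (x' : nat -> G') :
  prufer_chain x -> chain_generates x ->
  prufer_chain x' -> chain_generates x' -> group_isomorphic G G'.
Proof.
have map_exists (A B : groupType) (a : nat -> A) (b : nat -> B) :
    prufer_chain a -> chain_generates a -> prufer_chain b ->
    exists f : A -> B, forall n k, f (a n ^+ k) = b n ^+ k.
  move=> aP agen bP.
  have /choice[f fP] y : exists w, exists n k, y = a n ^+ k /\ w = b n ^+ k.
    by have [n [k ->]] := agen y; exists (b n ^+ k), n, k.
  exists f => n k; have [m [l [e ->]]] := fP (a n ^+ k).
  move: e; rewrite (chain_level aP n m) (chain_level aP m n) (addnC m).
  move=> /(chain_eq aP)/(chain_eq bP).
  by rewrite -(chain_level bP) addnC -(chain_level bP) => ->.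
move=> xP xg xP' xg'.
have [f fE] := map_exists _ _ _ _ xP xg xP'.
have [g gE] := map_exists _ _ _ _ xP' xg' xP.
apply: (@group_isomorphicP _ _ f).
  move=> y z; have [n [k [l [-> ->]]]] := chain_common xP xg y z.
  by rewrite -expgnDr !fE expgnDr.
exists g => y; [have [n [k ->]] := xg y|have [n [k ->]] := xg' y].
  by rewrite fE gE.
by rewrite gE fE.
Qed.

Lemma prufer_valX (y : prufer q) k :
  prufer_val (y ^+ k) = (prufer_val y ^+ k)%R.
Proof.
elim: k => [|k IH]; first by rewrite expg0 expr0.
by rewrite expgS exprS -IH.
Qed.

(** Start from a primitive q-th root of unity and extract q-th roots; the
    n-th term is then a primitive root of order q ^ n, hence generates all
    roots of unity of that order. *)
Lemma prufer_has_chain :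
  exists2 x : nat -> prufer q, prufer_chain x & chain_generates x.
Proof.
have q0 := prime_gt0 q_prime.
have [w wP] := C_prim_root_exists q0.
pose c n : algC := if n is m.+1 then iter m (q.-root)%R w else 1%R.
have cS n : (c n.+1 ^+ q = c n)%R.
  case: n => [|n] /=; first exact: prim_expr_order wP.
  by rewrite rootCK.
have c1 n : (c n ^+ (q ^ n) = 1)%R.
  elim: n => [|n IH]; first by rewrite expr1n.
  by rewrite expnS exprM cS.
have cP n : p_power_root_of_unity q (c n).
  apply/asboolP; split; last by exists n.
  apply/eqP => c0; have := c1 n; rewrite c0 expr0n expn_eq0.
  by case: q q0 => // ? _ /= /eqP; rewrite eq_sym oner_eq0.
pose x n : prufer q := Prufer (cP n).
have xP : prufer_chain x.
  split; first exact: val_inj.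
    move=> /(congr1 val) /= w1; move: wP; rewrite /c /= in w1; rewrite w1.
    by move=> /prim_order_dvd/(_ 1%N); rewrite expr1 eqxx dvdn1 => /eqP q1;
      move: q_prime; rewrite q1.
  by move=> n; apply: val_inj; rewrite /= prufer_valX cS.
exists x => // -[z zP]; have /asboolP[_ [n zn]] := zP.
have prim : ((q ^ n).-primitive_root (c n))%R.
  apply/andP; split; first by rewrite expn_gt0 q0.
  apply/forallP => i; apply/eqP; rewrite unity_rootE.
  apply/eqP/eqP => [ci|->]; last exact: c1.
  apply/eqP; rewrite eqn_leq ltn_ord /= dvdn_leq//.
  by apply/(chain_order xP)/val_inj; rewrite /= prufer_valX.
have [k zk] := prim_rootP prim zn.
by exists n, k; apply: val_inj; rewrite /= prufer_valX.
Qed.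

End PruferChain.

(** * Infinite groups with all proper subgroups finite *)

(** This excludes Tarski monsters, whose proper subgroups are also finite:
    they contain infinitely many subgroups of the same prime order. *)
Definition locally_finite (G : groupType) : Prop :=
  forall n (H : subgroup G), finite_set [set K | commens n H K].

Section QuasiFinite.
Variable G : groupType.
Implicit Types (x y z : G) (s t : seq G) (H K : subgroup G).

Lemma centralizer_closed x : group_closed [in [set y | commute x y]].
Proof.
split=> [|y z /set_mem/= xy /set_mem/= xz]; apply/mem_set => /=.
  exact: commute1.
by apply: commuteM => //; exact: commuteV.
Qed.

Definition centralizer x := Subgroup (@centralizer_closed x).

(** Orbit and stabiliser: two elements conjugating x to the same element
    lie in the same coset of the centralizer. *)
Lemma centralizer_covers x (A : set G) : finite_set A ->
  (forall y, A (y * x * y^-1)) ->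
  exists s, covers s (sg_full G) (centralizer x).
Proof.
move=> /finite_seqP[t At] conjA.
have /choice[h hP] y : exists w, (exists v, y = v * x * v^-1) -> y = w * x * w^-1.
  have [[v yv]|no] := pselect (exists v, y = v * x * v^-1); first by exists v.
  by exists 1 => /no.
exists (map h t) => y _; exists (h (y * x * y^-1)).
  by apply: map_f; have := conjA y; rewrite At.
have e : y * x * y^-1 = h (y * x * y^-1) * x * (h (y * x * y^-1))^-1.
  by apply: hP; exists y.
set w := h _ in e *; rewrite /= /commute; apply: (@mulgI _ w).
by rewrite !mulgA mulgV mul1g -e mulgVK.
Qed.

Lemma commute_pow_closed n : (forall x y, commute x y) ->
  group_closed [in [set x ^+ n | x in [set: G]]].
Proof.
move=> GC; split=> [|_ _ /set_mem[x _ <-] /set_mem[y _ <-]]; apply/mem_set.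
  by exists 1 => //; rewrite expg1n.
by exists (x / y) => //; rewrite expgnFl.
Qed.

Lemma chain_union_closed (x : nat -> G) :
  (forall n, x n \insg cyc (x n.+1)) ->
  group_closed [in [set y | exists n, y \insg cyc (x n)]].
Proof.
move=> xS.
have up n m y : y \insg cyc (x n) -> y \insg cyc (x (n + m)%N).
  elim: m => [|m IH]; first by rewrite addn0.
  by move=> /IH; rewrite addnS; exact: sub_cyc.
split=> [|y z /set_mem/= [n yn] /set_mem/= [m zm]]; apply/mem_set => /=.
  by exists 0%N; exact: (sg1 (cyc (x 0%N))).
exists (n + m)%N; apply: (@sgM _ (cyc (x (n + m)%N))); first exact: up.
by apply: (@sgV _ (cyc (x (n + m)%N))); rewrite addnC; exact: up.
Qed.

(** Every proper subgroup is finite and G is infinite without proper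
    subgroups of finite index. Local finiteness leaves only finitely many
    elements of each order, so each conjugacy class is finite, each centralizer
    has finite index and G is abelian. A power map x |-> x ^ n has finite
    kernel, hence infinite image, so G is divisible. An element of prime order q
    therefore starts a chain of q-th roots; the union of the cyclic groups that
    they generate is infinite, so it is G. *)
Lemma isolated_full : isolated (sg_full G) -> locally_finite G ->
  exists2 q, prime q & group_isomorphic G (prufer q).
Proof.
move=> [[H0 H0F] iso conn] lf.
have [a aH0] := neq_sg_full H0F.
have a1 : a <> 1 by move=> a1; apply: aH0; rewrite a1; exact: sg1.
have TF : sg_triv G <> sg_full G.
  by move=> TF; apply: a1; have : a \insg sg_full G by []; rewrite -TF.
have fin K : K <> sg_full G -> exists s, forall x, x \insg K -> x \in s.
  move=> KF; have [n [_ [s cs _]]] := conn _ _ TF KF.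
  by exists s; exact: covers_triv.
have inf s : ~ forall x, x \in s.
  move=> sP; apply: TF; apply: (iso (size s)); apply: commens_sym.
  exact: (commens_triv (s := s)).
have torsK K x : K <> sg_full G -> x \insg K -> exists n, x ^+ n.+1 = 1.
  move=> /fin[s sP] Kx.
  have cs : covers s K (sg_triv G) by apply: covers_all.
  have [k [k0 _ xk]] := pow_in_covered cs (leqnn _) Kx.
  by exists k.-1; rewrite prednK.
have tors x : exists n, x ^+ n.+1 = 1.
  (* If x had infinite order, x ^ 2 would generate a proper infinite subgroup. *)
  have [/cycP[k xk]|xx] := pselect (x \insg cyc (x ^+ 2)).
    apply: contrapT => no.
    have xinf n : x ^+ n.+1 <> 1 by move=> xn; apply: no; exists n.
    have : 1%R = (2%:Z * k)%R.
      by apply: (zpow_inj xinf); rewrite zpow1 -zpowX.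
    lia.
  have [n xn] : exists n, x ^+ 2 ^+ n.+1 = 1.
    apply: torsK (cyc_gen _) => xF; apply: xx.
    by rewrite xF.
  by exists (2 * n.+1).-1; rewrite prednK// expgnA.
have finT n : finite_set [set x : G | x ^+ n.+1 = 1].
  have fs K : commens n.+1 (sg_triv G) K -> finite_set (K : set G).
    move=> [_ [s /covers_triv cs _]].
    by apply: sub_finite_set (finite_seq s) => x /cs.
  apply: sub_finite_set (bigcup_finite (lf n.+1 (sg_triv G)) fs).
  move=> x /= /commens_cyc_fin cx; exists (cyc x) => //; exact: cyc_gen.
have GC x y : commute x y.
  have [n xn] := tors x.
  have [|s cs] := @centralizer_covers x _ (finT n).
    move=> w /=; have -> : w * x * w^-1 = x ^ (w^-1).
      by rewrite /conjg invgK mulgA.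
    by rewrite -conjXg xn conj1g.
  have : y \insg sg_full G by [].
  rewrite -(iso (size s) (centralizer x))//.
  by apply: commens_sym; apply: commens_sub cs (leqnn _).
have div n x : exists y, y ^+ n.+1 = x.
  (* If the image P were finite, G would be covered by the products of chosen
     roots of its elements with elements of the finite kernel. *)
  pose P := Subgroup (commute_pow_closed n.+1 GC).
  suff PF : P = sg_full G.
    have [y _ yx] : x \insg P by rewrite PF.
    by exists y.
  apply: contrapT => /fin[s sP].
  have /finite_seqP[t tP] := finT n.
  have /choice[h hP] y : exists w, y \insg P -> w ^+ n.+1 = y.
    have [[w _ wy]|no] := pselect (y \insg P); first by exists w.
    by exists 1 => /no.
  apply: (inf (allpairs (fun u v : G => u * v) (map h s) t)) => y.
  have yP : y ^+ n.+1 \insg P by exists y.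
  rewrite -(mulVKg (h (y ^+ n.+1)) y); apply: allpairs_f.
    by apply: map_f; exact: sP.
  have : [set` t] ((h (y ^+ n.+1))^-1 * y); last by [].
  by rewrite -tP /= expgMn// expVgn hP// mulVg.
have [q q_prime [y yq y1]] : exists2 q, prime q &
    exists2 y : G, y ^+ q = 1 & y <> 1.
  have exn : exists n, a ^+ n.+1 == 1 by have [n /eqP] := tors a; exists n.
  have [n /eqP an nmin] := ex_minnP exn.
  have n1 : (1 < n.+1)%N by rewrite ltnS lt0n; apply/eqP => n0; rewrite n0 expg1 in an.
  have qd := pdiv_dvd n.+1; have q_prime := pdiv_prime n1.
  exists (pdiv n.+1) => //; exists (a ^+ (n.+1 %/ pdiv n.+1)).
    by rewrite -expgnA divnK.
  have d0 : (0 < n.+1 %/ pdiv n.+1)%N by rewrite divn_gt0 ?prime_gt0// dvdn_leq.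
  rewrite -(prednK d0) => /eqP/nmin; apply/negP; rewrite -ltnNge.
  by rewrite -ltnS prednK// ltn_Pdiv// prime_gt1.
have /choice[root rootP] x : exists w, w ^+ q = x.
  by have [w wx] := div q.-1 x; exists w; rewrite -wx prednK// prime_gt0.
pose x n := if n is m.+1 then iter m root y else 1.
have xP : prufer_chain q x by split=> // -[|n] //=.
have xS n : x n \insg cyc (x n.+1).
  by case: xP => _ _ /(_ n) <-; apply: sgX; exact: cyc_gen.
pose U := Subgroup (chain_union_closed xS).
have UF : U = sg_full G.
  apply: contrapT => /fin[s sP].
  have cs : covers s U (sg_triv G) by apply: covers_all.
  have [|i [j [ij _ /= xij]]] := covers_pigeonhole (u := x) cs (leqnn _).
    by move=> i _; exists i; exact: cyc_gen.
  have xji : x j = x i by rewrite -(mulVKg (x i) (x j)) xij mulg1.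
  have : x j ^+ (q ^ i) = 1 by rewrite xji; apply/(chain_order q_prime xP).
  move=> /(chain_order q_prime xP); rewrite dvdn_Pexp2l ?prime_gt1//.
  by rewrite leqNgt ij.
have xgen : chain_generates x.
  move=> z; have [n zn] : z \insg U by rewrite UF.
  have xn : x n ^+ (q ^ n).-1.+1 = 1.
    by rewrite prednK ?expn_gt0 ?prime_gt0//; apply/(chain_order q_prime xP).
  by have [k _ ->] := cyc_finP xn zn; exists n, k.
exists q => //; have [x' xP' xgen'] := prufer_has_chain q_prime.
exact: chain_isomorphic xP xgen xP' xgen'.
Qed.

End QuasiFinite.

(** If neither the trivial nor the whole subgroup is isolated, they are
    close to each other, so G is finite and nothing is isolated. *)
Lemma isolated_dichotomy (G : groupType) (H : subgroup G) :
  isolated H -> locally_finite G ->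
  group_isomorphic G Zgroup \/ exists2 q, prime q & group_isomorphic G (prufer q).
Proof.
move=> isoH lf; have [[K KH] iso conn] := isoH.
have [HT|HT] := pselect (H = sg_triv G).
  by left; apply: isolated_triv; rewrite -HT.
have [HF|HF] := pselect (H = sg_full G).
  by right; apply: isolated_full => //; rewrite -HF.
have [n [_ [s /covers_triv sP _]]] :=
  conn _ _ (nesym HT : sg_triv G <> H) (nesym HF : sg_full G <> H).
case: KH; apply: (iso (size s)).
have all (L M : subgroup G) : exists2 r, covers r L M & (size r <= size s)%N.
  by exists s => //; apply: covers_all => x _; exact: sP.
by split.
Qed.

(** * Invariance under coarse equivalence *)

Lemma isolated_coarse (G G' : groupType) (H' : subgroup G') :
  coarse_equiv G G' -> isolated H' -> exists H : subgroup G, isolated H.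
Proof.
move=> [f [g [fg gf bf bg]]] [[K' KH'] iso conn]; exists (g H').
have fK K : K <> g H' -> f K <> H' by move=> KH fKH; apply: KH; rewrite -fKH fg.
split.
- by exists (g K') => /(can_inj gf).
- move=> n K HK; have [m hm] := bf n.
  by apply: contrapT => /fK; apply; apply: (iso m); rewrite -[H'](gf) ; exact: hm.
- move=> K L /fK KH /fK LH; have [n hn] := conn _ _ KH LH.
  by have [m /(_ _ _ hn)] := bg n; rewrite !fg; exists m.
Qed.

Lemma locally_finite_coarse (G G' : groupType) :
  coarse_equiv G G' -> locally_finite G' -> locally_finite G.
Proof.
move=> [f [g [fg gf bf bg]]] lf n H; have [m hm] := bf n.
apply: sub_finite_set (finite_image g (lf m (f H))).
by move=> K /= /hm HK; exists (f K).
Qed.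

(** * Subgroups of the integers *)

Section Integers.
Implicit Types (x y : Zgroup) (H K : subgroup Zgroup).

Lemma ZgroupM x y : (x * y)%g = ((x : int) + (y : int))%R.
Proof. by []. Qed.

Lemma ZgroupV x : (x^-1)%g = (- (x : int))%R.
Proof. by []. Qed.

Lemma ZgroupX x n : (x ^+ n)%g = ((x : int) * n%:Z)%R.
Proof.
elim: n => [|n IH]; first by rewrite mulr0.
by rewrite expgS ZgroupM IH; lia.
Qed.

Lemma Zgroup_zpow x k : zpow x k = ((x : int) * k)%R.
Proof.
have [m [n ->]] := int_diffP k.
by rewrite zpowB ZgroupM ZgroupV !ZgroupX; lia.
Qed.

Lemma Zgroup_inf x : x <> 1 -> forall n, x ^+ n.+1 <> 1.
Proof.
move=> x1 n; rewrite ZgroupX => /eqP; rewrite mulf_eq0 orbF => /eqP.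
exact: x1.
Qed.

Lemma Zgroup_cyc_covers x : x <> 1 ->
  exists s, covers s (sg_full Zgroup) (cyc x).
Proof.
move=> x1; have x0 : (x : int) != 0%R by apply/eqP.
exists [seq i%:Z%R | i <- iota 0 (absz x)] => y _; exists (absz (y %% x)%Z)%:Z%R.
  by apply: map_f; rewrite mem_iota; lia.
apply/cycP; exists (y %/ x)%Z; rewrite Zgroup_zpow.
by rewrite ZgroupM ZgroupV; lia.
Qed.

Lemma Zgroup_isolated : isolated (sg_triv Zgroup).
Proof.
split.
- exists (sg_full Zgroup) => e.
  by have : (1%R : int) \insg sg_triv Zgroup by rewrite -e.
- move=> n K [_ [s cs sn]]; apply: contrapT => /neq_sg_triv[x Kx x1].
  have [k [k0 _ /= xk]] := pow_in_covered cs sn Kx.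
  by apply: (Zgroup_inf x1 (n := k.-1)); rewrite prednK.
- move=> H K /neq_sg_triv[x Hx x1] /neq_sg_triv[y Ky y1].
  have [s cs] := Zgroup_cyc_covers x1; have [t ct] := Zgroup_cyc_covers y1.
  exists (maxn (size s) (size t)); split.
    exists t; rewrite ?leq_maxr// => z _; have [//|w wt wz] := ct z.
    by exists w => //; exact: sub_cyc wz.
  exists s; rewrite ?leq_maxl// => z _; have [//|w wt wz] := cs z.
  by exists w => //; exact: sub_cyc wz.
Qed.

(** A subgroup containing x is determined by its elements in
    {0, ..., |x| - 1}. *)
Lemma Zgroup_finite_above x : x <> 1 ->
  finite_set [set K : subgroup Zgroup | x \insg K].
Proof.
move=> x1; have x0 : (x : int) != 0%R by apply/eqP.
pose pat K : {ffun 'I_(absz x) -> bool} :=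
  [ffun i : 'I_(absz x) => `[< (i : nat)%:Z%R \insg K >]].
have pat_inj K L : x \insg K -> x \insg L -> pat K = pat L ->
    forall y, y \insg K -> y \insg L.
  move=> Kx Lx KL y Ky.
  have i_lt : (absz (y %% x)%Z < absz x)%N by lia.
  pose i := Ordinal i_lt; pose w : Zgroup := zpow x (y %/ x)%Z.
  have yE : y = ((i : nat)%:Z%R : Zgroup) * w.
    by rewrite ZgroupM /w Zgroup_zpow /=; lia.
  have /ffunP/(_ i) := KL; rewrite !ffunE => ii.
  rewrite yE; apply: sgM; last exact: sg_zpow.
  apply/asboolP; rewrite -ii; apply/asboolP.
  have -> : ((i : nat)%:Z%R : Zgroup) = y * w^-1 by rewrite yE mulgK.
  by apply: sgM => //; apply: sgV; exact: sg_zpow.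
have /choice[psi psiP] c : exists K, (exists L, x \insg L /\ pat L = c) ->
    x \insg K /\ pat K = c.
  have [[K Kc]|no] := pselect (exists L, x \insg L /\ pat L = c).
    by exists K.
  by exists (sg_triv Zgroup) => /no.
apply: (@sub_finite_set _ _ (range psi)).
  move=> K /= Kx; exists (pat K) => //.
  have [|Lx LK] := psiP (pat K); first by exists K.
  by apply: subgroupP => y; split; apply: pat_inj.
exact: finite_image.
Qed.

(** If n cosets of K cover H, then K contains x ^ n! for every x in H. *)
Lemma Zgroup_locally_finite : locally_finite Zgroup.
Proof.
move=> n H; have [->|/neq_sg_triv[x Hx x1]] := pselect (H = sg_triv Zgroup).
  apply: sub_finite_set (finite_set1 (sg_triv Zgroup)) => K.
  by case: Zgroup_isolated => _ iso _ /iso.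
have xn : (x : Zgroup) ^+ n`! <> 1.
  by rewrite -(prednK (fact_gt0 n)); apply: Zgroup_inf.
apply: sub_finite_set (Zgroup_finite_above xn) => K [[s cs sn] _] /=.
have [k [k0 kn xk]] := pow_in_covered cs sn Hx.
have /dvdnP[j ->] : k %| n`! by apply: dvdn_fact; rewrite k0.
by rewrite mulnC expgnA; exact: sgX.
Qed.

End Integers.

(** * Subgroups of the Prüfer group *)

(** The coarse model of the subgroups of the Prüfer group: Some n is the
    subgroup of order p ^ n and None the whole group, at infinite distance from
    all the others. *)
Definition odist_le (k : nat) (u v : option nat) : bool :=
  match u, v with
  | None, None => true
  | Some m, Some n => (m <= n + k)%N && (n <= m + k)%N
  | _, _ => false
  end.

Lemma odist_le_trans k l u v w :
  odist_le k u v -> odist_le l v w -> odist_le (k + l) u w.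
Proof. by case: u v w => [?|] [?|] [?|] //=; lia. Qed.

Section PruferSubgroups.
Variables (p : nat) (p_prime : prime p) (G : groupType) (x : nat -> G).
Hypotheses (xP : prufer_chain p x) (xgen : chain_generates x).

Lemma chain_mem m n : x m \insg cyc (x n) <-> (m <= n)%N.
Proof.
split=> [|mn].
  have xn : x n ^+ (p ^ n).-1.+1 = 1.
    by rewrite prednK ?expn_gt0 ?prime_gt0//; apply/(chain_order p_prime xP).
  case/(cyc_finP xn) => k _ xk.
  have : x m ^+ (p ^ n) = 1.
    by rewrite xk -expgnA mulnC expgnA (chain_order p_prime xP n _).2 ?expg1n.
  by move=> /(chain_order p_prime xP); rewrite dvdn_Pexp2l ?prime_gt1.
by rewrite -(chain_shift xP m (n - m)) subnKC//; apply: sgX; exact: cyc_gen.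
Qed.

Lemma chain_sub m n : (m <= n)%N ->
  forall y, y \insg cyc (x m) -> y \insg cyc (x n).
Proof. by move=> mn; apply: sub_cyc; apply/chain_mem. Qed.

(** The elements x n, ..., x (n + k) lie in different cosets of the
    subgroup generated by x n. *)
Lemma chain_covers_size s (H : subgroup G) n k : covers s H (cyc (x n)) ->
  (forall i, (i <= k)%N -> x (n + i)%N \insg H) -> (k < size s)%N.
Proof.
move=> cs xH; rewrite ltnNge; apply/negP => sk.
have [i [j [ij _ xij]]] := covers_pigeonhole (u := fun i => x (n + i)%N) cs sk xH.
have : x (n + j)%N \insg cyc (x (n + i)%N).
  rewrite -(mulVKg (x (n + i)%N) (x (n + j)%N)); apply: sgM; first exact: cyc_gen.
  exact: (chain_sub (leq_addr i n) xij).
by rewrite chain_mem leq_add2l leqNgt ij.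
Qed.

Definition chain_subgroup (u : option nat) : subgroup G :=
  if u is Some n then cyc (x n) else sg_full G.

Lemma chain_subgroup_near k u v :
  commens k (chain_subgroup u) (chain_subgroup v) -> odist_le k u v.
Proof.
have far n : ~ commens k (cyc (x n)) (sg_full G).
  move=> [_ [s cs sk]]; suff : (k < size s)%N by rewrite ltnNge sk.
  exact: (chain_covers_size cs).
have near_le m n : commens k (cyc (x m)) (cyc (x n)) -> (n <= m + k)%N.
  move=> [_ [s cs sk]]; rewrite leqNgt; apply/negP => mn.
  suff : (k < size s)%N by rewrite ltnNge sk.
  by apply: (chain_covers_size cs) => i ik; apply/chain_mem; lia.
case: u v => [m|] [n|] //= c; rewrite /odist_le.
- by rewrite (near_le m n)// (near_le n m)//; exact: commens_sym.
- by case: (far m).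
- by case: (far n); exact: commens_sym.
Qed.

Lemma near_chain_subgroup k u v :
  odist_le k u v -> commens (p ^ k) (chain_subgroup u) (chain_subgroup v).
Proof.
have p_gt0 := prime_gt0 p_prime.
have le m n : (m <= n)%N -> (n <= m + k)%N ->
    commens (p ^ k) (cyc (x m)) (cyc (x n)).
  move=> mn nk; apply: (@commens_le _ (p ^ (n - m))).
    by rewrite leq_pexp2l//; lia.
  rewrite -(chain_shift xP m (n - m)) subnKC//.
  by apply: commens_cyc_pow; rewrite expn_gt0 p_gt0.
case: u v => [m|] [n|] //=.
  case/andP=> mk nk; have [mn|/ltnW nm] := leqP m n; first exact: le.
  by apply: commens_sym; apply: le.
move=> _; apply: commens_sub (covers_sub _) _ => //.
by rewrite expn_gt0 p_gt0.
Qed.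

(** A subgroup containing some x n ^ k with k prime to p contains x n; so if
    it misses x n.+1 but contains x n, it is generated by x n. *)
Lemma chain_subgroup_surj (H : subgroup G) : exists u, H = chain_subgroup u.
Proof.
have [all|/existsNP[n0 xn0]] := pselect (forall n, x n \insg H).
  exists None; apply: subgroupP => y; split=> // _.
  by have [n [k ->]] := xgen y; apply: sgX.
have exn : exists n, `[< ~ x n \insg H >] by exists n0; apply/asboolP.
have [n /asboolP xn nmin] := ex_minnP exn.
case: n xn nmin => [|n] xn nmin.
  by case: xn; case: xP => -> _ _; exact: sg1.
have xmem m : x m \insg H -> (m <= n)%N.
  move=> xm; rewrite leqNgt; apply/negP => nm; apply: xn.
  by apply: (sub_cyc xm); apply/chain_mem.
exists (Some n); apply: subgroupP => y; split; last first.
  apply: sub_cyc; apply: contrapT => xn'.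
  by have := nmin n; rewrite ltnn => H'; have := H' (asboolT xn').
have [m [k ->]] := xgen y.
elim: m k => [|m IH] k; first by case: xP => -> _ _ _; rewrite expg1n; exact: sg1.
move=> Hxk; have [/dvdnP[j kj]|pk] := boolP (p %| k)%N.
  have e : x m.+1 ^+ k = x m ^+ j by case: xP => _ _ xS; rewrite kj mulnC expgnA xS.
  by rewrite e; apply: IH; rewrite -e.
apply: sgX; apply/chain_mem/xmem.
have k0 : (0 < k)%N by case: (k) pk; rewrite ?dvdn0.
have : coprime k (p ^ m.+1) by rewrite coprime_sym coprimeXl// prime_coprime.
case/(coprimeP _ k0) => -[u v] /= uv.
have -> : x m.+1 = (x m.+1 ^+ k) ^+ u.
  rewrite -[LHS]expg1 -{1}uv expgnFr; last by lia.
  rewrite mulnC expgnA [(v * _)%N]mulnC (expgnA _ (p ^ _)).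
  by rewrite [x m.+1 ^+ (p ^ _)](chain_order p_prime xP _ _).2// expg1n divg1.
exact: sgX.
Qed.

Lemma chain_subgroup_inj : injective chain_subgroup.
Proof.
have cyc_full n : cyc (x n) <> sg_full G.
  move=> e; have : x n.+1 \insg cyc (x n) by rewrite e.
  by rewrite chain_mem ltnn.
case=> [m|] [n|] //=; last 2 first.
- by move=> /cyc_full.
- by move=> /esym/cyc_full.
move=> e; congr Some; apply/eqP; rewrite eqn_leq; apply/andP.
by split; apply/chain_mem; [rewrite -e|rewrite e]; exact: cyc_gen.
Qed.

End PruferSubgroups.

Lemma prufer_model p : prime p ->
  exists (E : option nat -> subgroup (prufer p)) (D : subgroup (prufer p) -> option nat),
  [/\ cancel E D, cancel D E,
    forall k u v, commens k (E u) (E v) -> odist_le k u v &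
    forall k u v, odist_le k u v -> commens (p ^ k) (E u) (E v)].
Proof.
move=> p_prime; have [x xP xgen] := prufer_has_chain p_prime.
have /choice[D DP] := chain_subgroup_surj p_prime xP xgen.
exists (chain_subgroup x), D; split.
- by move=> u; apply: (chain_subgroup_inj p_prime xP); rewrite -DP.
- by move=> H; rewrite -DP.
- by move=> k u v; exact: (chain_subgroup_near p_prime xP).
- by move=> k u v; exact: near_chain_subgroup.
Qed.

(** The model depends on p only through the constant in the bounds. *)
Lemma prufer_coarse_equiv p q : prime p -> prime q ->
  coarse_equiv (prufer p) (prufer q).
Proof.
move=> /prufer_model[E [D [ED DE EN NE]]] /prufer_model[E' [D' [ED' DE' EN' NE']]].
exists (E' \o D), (E \o D'); split.
- by move=> H /=; rewrite ED' DE.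
- by move=> H /=; rewrite ED DE'.
- by move=> n; exists (q ^ n)%N => H K; rewrite -{1}(DE H) -{1}(DE K) => /EN/NE'.
- by move=> n; exists (p ^ n)%N => H K; rewrite -{1}(DE' H) -{1}(DE' K) => /EN'/NE.
Qed.

Lemma prufer_isolated p : prime p -> exists H : subgroup (prufer p), isolated H.
Proof.
move=> /prufer_model[E [D [ED DE EN NE]]]; exists (E None); split.
- by exists (E (Some 0%N)) => /(can_inj ED).
- by move=> n K; rewrite -(DE K) => /EN; case: (D K).
- move=> K L; rewrite -(DE K) -(DE L).
  case: (D K) (D L) => [m|] [n|] // _ _.
  by exists (p ^ (m + n))%N; apply: NE => /=; lia.
Qed.

Lemma prufer_locally_finite p : prime p -> locally_finite (prufer p).
Proof.
move=> /prufer_model[E [D [ED DE EN NE]]] n H.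
pose s := None :: map Some (iota 0 (odflt 0%N (D H) + n).+1).
apply: (@sub_finite_set _ _ (E @` [set` s])); last exact/finite_image/finite_seq.
move=> K /=; rewrite -{1}(DE H) -{1}(DE K) => /EN HK; exists (D K) => //=.
case: (D K) HK => [j|//]; case DH: (D H) => [i|//] ij.
rewrite /s DH inE; apply/orP; right; apply: map_f; rewrite mem_iota.
by move: ij => /=; lia.
Qed.

(** * Growth separates the integers from the Prüfer group *)

Lemma cyc_pow_inj (G : groupType) (x : G) : (forall n, x ^+ n.+1 <> 1) ->
  injective (fun n => cyc (x ^+ n)).
Proof.
move=> inf m n e; apply/eqP; rewrite eqn_dvd.
have dv i j : cyc (x ^+ i) = cyc (x ^+ j) -> (i %| j)%N.
  move=> eij; have : x ^+ j \insg cyc (x ^+ i) by rewrite eij; exact: cyc_gen.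
  move=> /cycP[k]; rewrite zpowX => xjk.
  have : j%:Z%R = (i%:Z * k)%R by apply: (zpow_inj inf); rewrite -xjk.
  by move=> jk; apply/dvdnP; exists (absz k); lia.
by rewrite !dv.
Qed.

(** Unique factorization, read off from the 2-adic and 3-adic valuations. *)
Lemma expn23_inj a b c d : (2 ^ a * 3 ^ b = 2 ^ c * 3 ^ d)%N -> a = c /\ b = d.
Proof.
move=> e; split.
  by have := congr1 (logn 2) e; rewrite !lognM ?expn_gt0// !lognX /= !muln1 !muln0 !addn0.
by have := congr1 (logn 3) e; rewrite !lognM ?expn_gt0// !lognX /= !muln1 !muln0.
Qed.

(** The subgroups generated by 2 ^ a * 3 ^ b with a, b < M form M ^ 2 distinct
    points that are reached from one point by fewer than 2 M steps of index at
    most 3, whereas a walk of that length stays among O(M) points of the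
    model. *)
Lemma no_option_nat_embedding (D : subgroup Zgroup -> option nat) C :
  injective D ->
  ~ (forall H K, commens 3 H K -> odist_le C (D H) (D K)).
Proof.
move=> Dinj bnd; pose g : Zgroup := 1%R.
have ginf : forall n, g ^+ n.+1 <> 1 by apply: Zgroup_inf.
pose t n := D (cyc (g ^+ n)).
have t_inj : injective t by move=> m n /Dinj/(cyc_pow_inj ginf).
have step n c : (0 < c <= 3)%N -> odist_le C (t n) (t (n * c)%N).
  move=> /andP[c0 c3]; apply: bnd; apply: commens_sym; apply: commens_le c3 _.
  by rewrite expgnA; exact: commens_cyc_pow.
have walk a b : odist_le ((a + b) * C) (t 1%N) (t (2 ^ a * 3 ^ b)%N).
  elim: a => [|a IH]; last first.
    rewrite addSn mulSn addnC; apply: odist_le_trans IH _.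
    by rewrite expnS -mulnA [X in odist_le _ _ (t X)]mulnC; exact: step.
  elim: b => [|b IH]; first by rewrite muln1; case: (t 1%N) => //= n; lia.
  rewrite addnS mulSn addnC; apply: odist_le_trans IH _.
  by rewrite expnS mulnCA [X in odist_le _ _ (t X)]mulnC; exact: step.
case t1 : (t 1%N) => [n|]; last first.
  have := walk 1%N 0%N; rewrite t1; case t2 : (t _) => // _.
  by have := t_inj _ _ (etrans t1 (esym t2)).
(* With this M, the number M ^ 2 of points exceeds the bound n + 2 M C + 1. *)
pose M := (n + C + C).+2.
have tE a b : exists2 k, t (2 ^ a * 3 ^ b)%N = Some k & (k <= n + (a + b) * C)%N.
  by have := walk a b; rewrite t1; case: (t _) => // k /= /andP[_ ?]; exists k.
pose N := (n + (M + M) * C)%N.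
pose F (ab : 'I_M * 'I_M) : 'I_N.+1 :=
  inord (odflt 0%N (t (2 ^ ab.1 * 3 ^ ab.2)%N)).
have F_inj : injective F.
  move=> [a b] [c d] /(congr1 val) /=.
  have [k tk kN] := tE a b; have [l tl lN] := tE c d.
  rewrite /F /= tk tl /= !inordK; first last.
  - by rewrite ltnS (leq_trans kN)// leq_add2l leq_mul2r leq_add ?orbT// ltnW.
  - by rewrite ltnS (leq_trans lN)// leq_add2l leq_mul2r leq_add ?orbT// ltnW.
  move=> kl; rewrite -kl -tk in tl.
  by have [/val_inj-> /val_inj->] := expn23_inj (t_inj _ _ tl).
have := leq_card F F_inj; rewrite card_prod !card_ord /N /M; nia.
Qed.

Lemma Zgroup_not_prufer p : prime p -> ~ coarse_equiv Zgroup (prufer p).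
Proof.
move=> /prufer_model[E [D [ED DE EN NE]]] [f [g [fg gf bf _]]].
have [m hm] := bf 3.
apply: (@no_option_nat_embedding (D \o f) m).
  by apply: inj_comp; [exact: can_inj DE|exact: can_inj fg].
by move=> H K /hm; rewrite -{1}(DE (f H)) -{1}(DE (f K)) => /EN.
Qed.

Local Close Scope group_scope.
Local Close Scope classical_set_scope.
Local Open Scope ring_scope.

Theorem theorem2 (R : realType) (b : R) (b_gt1 : 1 < b)
    (G : groupType) (p : nat) (p_prime : prime p) :
  (asymorphic (log_hyperballean b_gt1 G) (log_hyperballean b_gt1 Zgroup)
     <-> group_isomorphic G Zgroup) /\
  (asymorphic (log_hyperballean b_gt1 G) (log_hyperballean b_gt1 (prufer p))
     <-> exists2 q : nat, prime q & group_isomorphic G (prufer q)).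
Proof.
rewrite !asymorphicP; split; split=> [GZ|iso].
- have [H isoH] := isolated_coarse GZ Zgroup_isolated.
  have lf := locally_finite_coarse GZ Zgroup_locally_finite.
  have [//|[q q_prime Gq]] := isolated_dichotomy isoH lf.
  case: (Zgroup_not_prufer q_prime); apply: coarse_equiv_trans.
    exact: coarse_equiv_sym GZ.
  exact: coarse_equiv_iso.
- exact: coarse_equiv_iso.
- have [H' isoH'] := prufer_isolated p_prime.
  have [H isoH] := isolated_coarse GZ isoH'.
  have lf := locally_finite_coarse GZ (prufer_locally_finite p_prime).
  have [GZ'|//] := isolated_dichotomy isoH lf.
  case: (Zgroup_not_prufer p_prime); apply: coarse_equiv_trans GZ.
  exact/coarse_equiv_sym/coarse_equiv_iso.
- have [q q_prime Gq] := iso.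
  apply: coarse_equiv_trans (coarse_equiv_iso Gq) _.
  exact: prufer_coarse_equiv.
Qed.
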